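(* Let $q,\bar q,p,\bar p\colon\mathbb{R}\to\mathbb{R}$ be BPUC functions which are norm-bounded by a constant $\kappa$, and let $\lambda^*(q,p)$ and $\lambda^*(\bar q,\bar p)$ be the corresponding bifurcation values. Then there exists a constant $m_\kappa$ (depending only on $\kappa$) such that $$|\lambda^*(\bar q,\bar p)-\lambda^*(q,p)|\le m_\kappa\big(\|\bar q-q\|+\|\bar p-p\|\big).$$ In particular, the map $\lambda^*\colon BPUC(\mathbb{R},\mathbb{R})\times BPUC(\mathbb{R},\mathbb{R})\to\mathbb{R}$ is continuous.
   Context: BPUC functions: a set $\Delta=\{a_j\mid j\in\mathbb{Z}\}\subset\mathbb{R}$ is disperse if $\inf_{j\in\mathbb{Z}}(a_{j+1}-a_j)>0$. $BPUC_\Delta(\mathbb{R},\mathbb{R})$ is the set of bounded right-continuous functions $q\colon\mathbb{R}\to\mathbb{R}$ such that for all $\varepsilon>0$ there is $\delta>0$ such that, if $t_1,t_2\in(a_j,a_{j+1})$ for some $j\in\mathbb{Z}$ and $|t_2-t_1|<\delta$, then $|q(t_2)-q(t_1)|<\varepsilon$. A function $q$ is BPUC if $q=q_1+\cdots+q_n$ with $q_i\in BPUC_{\Delta_i}(\mathbb{R},\mathbb{R})$ for finitely many disperse sets $\Delta_1,\dots,\Delta_n$. $BPUC(\mathbb{R},\mathbb{R})$ is the vector space of BPUC functions, with norm $\|q\|:=\sup_{t\in\mathbb{R}}|q(t)|$. Bifurcation value: for BPUC functions $q,p$, $\lambda^*(q,p)$ is the unique real number such that $x'=-x^2+q(t)x+p(t)+\lambda$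 has a solution defined and bounded on $\mathbb{R}$ if and only if $\lambda\ge\lambda^*(q,p)$ (such a number exists). Solutions are in the Carathéodory sense (absolutely continuous on compact intervals and satisfying the equation a.e.). *)

(* Defs.v *)
From HB Require Import structures.
From mathcomp Require Import all_boot all_order all_algebra.
From mathcomp Require Import all_classical all_reals all_analysis.

Set Implicit Arguments.
Unset Strict Implicit.
Unset Printing Implicit Defensive.

Import Order.TTheory GRing.Theory Num.Theory.
Import numFieldNormedType.Exports.

Local Open Scope classical_set_scope.
Local Open Scope ring_scope.

Section BPUC.
Context {R : realType}.
Implicit Types (a : int -> R) (q p x : R -> R).

(* A set Delta = {a_j | j in Z} is given by its enumeration a. Since inf is 0
   on sets that are not bounded below, the positivity also says that the gaps
   are bounded below. *)
Definition disperse a : Prop :=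
  0 < inf [set a (j + 1) - a j | j in [set: int]].

Definition BPUC_on a q : Prop :=
  [/\ exists M : R, forall t, `|q t| <= M,
      right_continuous q
    & forall e : R, 0 < e -> exists2 d : R, 0 < d &
        forall (j : int) (t1 t2 : R),
          t1 \in `]a j, a (j + 1)[ -> t2 \in `]a j, a (j + 1)[ ->
          `|t2 - t1| < d -> `|q t2 - q t1| < e].

Definition is_BPUC q : Prop :=
  exists (n : nat) (a : 'I_n -> int -> R) (qs : 'I_n -> R -> R),
    [/\ forall i, disperse (a i),
        forall i, BPUC_on (a i) (qs i)
      & q = \sum_(i < n) qs i].

Definition bpuc : {pred R -> R} := [pred q | `[< is_BPUC q >]].

Lemma BPUC_onZ a (c : R) q : BPUC_on a q -> BPUC_on a (c *: q).
Proof.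
move=> [[M qM] qr qu]; split.
- by exists (`|c| * M) => t; rewrite normrM ler_wpM2l.
- by move=> t; apply: cvgM; [exact: cvg_cst|exact: qr].
- move=> e e0.
  have c0 : 0 < `|c| + 1 by rewrite ltr_pwDr.
  have [d d0 H] := qu _ (divr_gt0 e0 c0).
  exists d => // j t1 t2 h1 h2 h3.
  have -> : (c *: q) t2 - (c *: q) t1 = c * (q t2 - q t1) by rewrite mulrBr.
  rewrite normrM; apply: (@le_lt_trans _ _ ((`|c| + 1) * `|q t2 - q t1|)).
    by rewrite ler_wpM2r// lerDl.
  by rewrite mulrC -ltr_pdivlMr//; exact: H h1 h2 h3.
Qed.

Lemma is_BPUC0 : is_BPUC 0.
Proof.
exists 0%N, (fun _ _ => 0), (fun _ _ => 0).
by split; [case|case|rewrite big_ord0].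
Qed.

Lemma is_BPUCD q p : is_BPUC q -> is_BPUC p -> is_BPUC (q + p).
Proof.
move=> [n [a [qs [ad aq ->]]]] [m [b [ps [bd bp ->]]]].
exists (n + m)%N,
  (fun i : 'I_(n + m) => match fintype.split i with inl k => a k | inr k => b k end),
  (fun i : 'I_(n + m) => match fintype.split i with inl k => qs k | inr k => ps k end).
split=> [i|i|]; do ?by case: (fintype.split i).
rewrite big_split_ord/=; congr (_ + _); apply: eq_bigr => i _.
  by rewrite -[lshift m i]/(unsplit (inl i)) unsplitK.
by rewrite -[rshift n i]/(unsplit (inr i)) unsplitK.
Qed.

Lemma is_BPUCZ (c : R) q : is_BPUC q -> is_BPUC (c *: q).
Proof.
move=> [n [a [qs [ad aq ->]]]].
exists n, a, (fun i => c *: qs i); split=> // [i|]; first exact: BPUC_onZ.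
by rewrite scaler_sumr.
Qed.

Lemma bpuc_submod_closed : submod_closed bpuc.
Proof.
split; first exact/asboolP/is_BPUC0.
move=> c q p /asboolP hq /asboolP hp.
by apply/asboolP/is_BPUCD => //; exact: is_BPUCZ.
Qed.

HB.instance Definition _ :=
  GRing.isSubmodClosed.Build R (R -> R) bpuc bpuc_submod_closed.

Lemma is_BPUC_bounded q : is_BPUC q -> exists M : R, forall t, `|q t| <= M.
Proof.
move=> [n [a [qs [_ aq ->]]]].
have H i : exists M : R, forall t, `|qs i t| <= M by case: (aq i).
exists (\sum_(i < n) sval (cid (H i))) => t.
rewrite fct_sumE (le_trans (ler_norm_sum _ _ _))//.
by apply: ler_sum => i _; case: (cid (H i)).
Qed.

End BPUC.

Record BPUC (R : realType) := MkBPUC {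
  BPUC_fun :> R -> R;
  BPUC_mem : BPUC_fun \in bpuc }.

Section BPUC_normed.
Context {R : realType}.

HB.instance Definition _ := [isSub for @BPUC_fun R].
HB.instance Definition _ := [Choice of BPUC R by <:].
HB.instance Definition _ := [SubChoice_isSubLmodule of BPUC R by <:].

Definition BPUC_norm (q : BPUC R) : R := sup [set `|q t| | t in [set: R]].

Lemma BPUC_has_sup (q : BPUC R) : has_sup [set `|q t| | t in [set: R]].
Proof.
split; first by exists `|q 0|, 0.
have [M qM] := is_BPUC_bounded (asboolW (BPUC_mem q)).
by exists M => _ [t _ <-].
Qed.

Lemma BPUC_norm_ub (q : BPUC R) t : `|q t| <= BPUC_norm q.
Proof. by apply: (sup_upper_bound (BPUC_has_sup q)); exists t. Qed.

Lemma BPUC_norm_le (q : BPUC R) (M : R) :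
  (forall t, `|q t| <= M) -> BPUC_norm q <= M.
Proof.
move=> qM; apply: ge_sup; first by case: (BPUC_has_sup q).
by move=> _ [t _ <-].
Qed.

Lemma BPUC_norm_ge0 (q : BPUC R) : 0 <= BPUC_norm q.
Proof. exact: le_trans (normr_ge0 _) (BPUC_norm_ub q 0). Qed.

Lemma BPUC_normD (q p : BPUC R) :
  BPUC_norm (q + p) <= BPUC_norm q + BPUC_norm p.
Proof.
apply: BPUC_norm_le => t; apply: le_trans (ler_normD _ _) _.
by rewrite lerD ?BPUC_norm_ub.
Qed.

Lemma BPUC_normZ (c : R) (q : BPUC R) : BPUC_norm (c *: q) = `|c| * BPUC_norm q.
Proof.
have le (k : R) (r : BPUC R) : BPUC_norm (k *: r) <= `|k| * BPUC_norm r.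
  by apply: BPUC_norm_le => t; rewrite normrM ler_wpM2l ?BPUC_norm_ub.
apply/eqP; rewrite eq_le le/=.
have [->|c0] := eqVneq c 0; first by rewrite normr0 mul0r BPUC_norm_ge0.
have := le c^-1 (c *: q); rewrite scalerA mulVf// scale1r normfV.
by rewrite -ler_pdivrMl ?invr_gt0 ?normr_gt0// invrK.
Qed.

Lemma BPUC_norm0_eq0 (q : BPUC R) : BPUC_norm q = 0 -> q = 0.
Proof.
move=> q0; apply/val_inj/funext => t; apply/eqP; rewrite -normr_le0 -q0.
exact: BPUC_norm_ub.
Qed.

HB.instance Definition _ :=
  Lmodule_isNormed.Build R (BPUC R) BPUC_normD BPUC_normZ BPUC_norm0_eq0.

Lemma BPUC_normE (q : BPUC R) : `|q| = sup [set `|q t| | t in [set: R]].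
Proof. by []. Qed.

End BPUC_normed.

Section bifurcation.
Context {R : realType}.
Implicit Types (q p x : R -> R).

Definition abs_continuous_on (a b : R) x : Prop :=
  forall e : R, 0 < e -> exists2 d : R, 0 < d &
    forall (n : nat) (u v : 'I_n -> R),
      (forall i, a <= u i /\ u i <= v i /\ v i <= b) ->
      trivIset [set: 'I_n] (fun i => [set` `]u i, v i[]) ->
      \sum_(i < n) (v i - u i) < d ->
      \sum_(i < n) `|x (v i) - x (u i)| < e.

Definition caratheodory_solution (f : R -> R -> R) x : Prop :=
  (forall a b : R, abs_continuous_on a b x) /\
  {ae @lebesgue_measure R, forall t : R, is_derive t 1 x (f t (x t))}.

Definition has_bounded_solution q p (lambda : R) : Prop :=
  exists x : R -> R,
    caratheodory_solution
      (fun t y => - y ^+ 2 + q t * y + p t + lambda) x /\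
    exists M : R, forall t, `|x t| <= M.

Definition is_bifurcation_value q p (l : R) : Prop :=
  forall lambda : R, has_bounded_solution q p lambda <-> l <= lambda.

Lemma is_bifurcation_value_unique q p (l l' : R) :
  is_bifurcation_value q p l -> is_bifurcation_value q p l' -> l = l'.
Proof.
move=> H H'; apply/eqP; rewrite eq_le.
by apply/andP; split; [apply/H/H'|apply/H'/H].
Qed.

(* The default value 0 is only taken if no bifurcation value exists. *)
Definition lambda_star (q p : BPUC R) : R :=
  xget 0 [set l | is_bifurcation_value q p l].

End bifurcation.

(* Main.v *)
Require Import Defs.
From HB Require Import structures.
From mathcomp Require Import all_boot all_order all_algebra.
From mathcomp Require Import all_classical all_reals all_analysis.
From mathcomp Require Import measurable_realfun ring lra.

(** Write [f_l(t, y) = - y^2 + q(t) y + p(t) + l].  Everything rests on one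
existence principle ([bounded_solution_of_subsolutions]): a bounded solution of
[x' = f_l(t, x)] exists as soon as, for every [n], the equation with parameter
[m = l + 1/(n+1)] has a Lipschitz subsolution [b] (that is, [b' <= f_m(t, b)]
almost everywhere) with a bound that does not depend on [n].

This principle gives the theorem.  A bounded solution [x] for [(q, p, l)] is a
subsolution for [(qbar, pbar, m)] whenever
[m >= l + sup |x| * |qbar - q| + |pbar - p|], because changing the coefficients
changes the right-hand side along [x] by at most that amount.  Applied to the
solution at [l = lambda_star q p] it yields
[lambda_star qbar pbar <= l + sup |x| * |qbar - q| + |pbar - p|], and exchanging
the two pairs gives the Lipschitz estimate, provided [sup |x|] is controlled by
[kappa] alone.  It is: where [|x| >= kappa + |l| + 2] the solution decreases at
speed at least 1, so a bounded [x] cannot get there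
([bounded_solution_norm_le]), and [lambda_star] itself lies between
[- kappa - kappa^2] and [kappa].  The same principle shows that the set of
parameters with a bounded solution is closed upwards and contains its infimum,
so that [lambda_star] really is the bifurcation value ([lambda_starP]).

The existence principle is a monotone iteration on the whole line.  For a large
constant [M], bounded solutions are the fixed points of
[u |-> A (u + f_l(., u) / M)], where [A g] is the average of [g] over the past
with exponential weight [M e^(- M (t - r)) dr]: it is the bounded solution of
[y' = M (g - y)].  The average is monotone, fixes constants, commutes with
bounded pointwise limits and is a Lipschitz function; for [M] large the inner
map is monotone as well.  Starting from a large constant, which is a
supersolution, and letting the parameter decrease to [l] along the iteration
gives a decreasing sequence; its [n]-th term lies above the [n]-th subsolution,
so the sequence is bounded and its limit is a fixed point.  No initial value
problem has to be solved.

To compare an absolutely continuous function with its almost everywhere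
derivative, [ae_derive_le] proves that an absolutely continuous function whose
derivative is at most [C] almost everywhere grows at most at speed [C]. *)

Set Implicit Arguments.
Unset Strict Implicit.
Unset Printing Implicit Defensive.

Import Order.TTheory GRing.Theory Num.Theory.
Import numFieldNormedType.Exports.

Local Open Scope classical_set_scope.
Local Open Scope ring_scope.

(** * Growth of absolutely continuous functions *)

Section monotonicity.
Context {R : realType}.
Notation mu := (@lebesgue_measure R).

(** Cousin's lemma in the form of an induction principle: the supremum of the
[s] with [Q a s] can be passed, since [Q] holds on small segments around it. *)
Lemma additive_segment_ind (Q : R -> R -> Prop) (a b : R) : a <= b ->
  (forall s t u, Q s t -> Q t u -> Q s u) ->
  (forall t, a <= t <= b -> exists2 r, 0 < r &
    forall s u, a <= s -> s <= t -> t <= u -> u <= b -> u - s < r -> Q s u) ->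
  Q a b.
Proof.
move=> ab Qtrans Qloc.
pose E := [set s | a <= s <= b /\ Q a s].
have Ea : E a.
  split; first by rewrite lexx.
  by have [|r r0] := Qloc a; [rewrite lexx|apply => //; rewrite subrr].
have Esup : has_sup E by split; [exists a|exists b => s [/andP[]]].
pose c := sup E.
have ac : a <= c by exact: (sup_upper_bound Esup).
have cb : c <= b by apply: ge_sup => [|s [/andP[]]//]; exists a.
have [|r r0 Qr] := Qloc c; first by rewrite ac.
have [s [/andP[as_ sb] Qas] cs] := sup_adherent (divr_gt0 r0 (ltr0Sn _ 1)) Esup.
have sc : s <= c by apply: (sup_upper_bound Esup); split=> //; rewrite as_.
have step u : c <= u -> u <= b -> u - c < r / 2 -> Q a u.
  move=> cu ub ucr; apply: Qtrans Qas _; apply: Qr => //.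
  by rewrite -/c in cs; lra.
have [bc|bc] := ltP (b - c) (r / 2); first exact: step.
pose u := c + r / 4.
suff : u <= c by rewrite /u; lra.
apply: (sup_upper_bound Esup); split; first by rewrite /u; lra.
by apply: step; rewrite /u; lra.
Qed.

(** Straddle estimate: the increment over a segment that contains [t] splits at
[t] into two increments, each controlled by the derivative at [t]. *)
Lemma is_derive_straddle (x : R -> R) (t d e : R) :
  is_derive t 1 x d -> 0 < e -> exists2 r, 0 < r &
    forall s u, s <= t -> t <= u -> u - s < r -> x u - x s <= (d + e) * (u - s).
Proof.
move=> [xd xE] e0.
have : h^-1 *: (x (h *: 1 + t) - x t) @[h --> 0^'] --> d by rewrite -xE.
move=> /cvgrPdist_lt/(_ e e0)[r r0 H].
have K h : `|h| < r -> `|x (h + t) - x t - h * d| <= e * `|h|.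
  move=> hr; have [->|h0] := eqVneq h 0.
    by rewrite add0r subrr mul0r subr0 normr0 mulr0.
  have /= := H h; rewrite sub0r normrN => /(_ hr h0) /ltW.
  rewrite [h *: 1]mulr1 => D; rewrite mulrC.
  rewrite (_ : _ - _ = - (h * (d - h^-1 *: (x (h + t) - x t)))).
    by rewrite normrN normrM mulrC ler_wpM2r.
  by rewrite mulrBr /GRing.scale/= mulVKf//; ring.
exists r => // s u st tu usr.
have := K (u - t); have := K (s - t); rewrite !subrK.
rewrite [`|s - t|]ler0_norm ?subr_le0// [`|u - t|]ger0_norm ?subr_ge0//.
move=> /(_ ltac:(lra)) /ler_normlP[A _] /(_ ltac:(lra)) /ler_normlP[_ B].
by nra.
Qed.

(** Cover the exceptional null set by an open set [U] of small measure.  By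
[additive_segment_ind] the segment splits into steps that either satisfy the
straddle estimate or lie in [U]; the latter have a small total length, so by
absolute continuity [x] hardly varies over their union. *)
Lemma ae_derive_le (x : R -> R) (a b C : R) : a <= b ->
  abs_continuous_on a b x ->
  {ae mu, forall t, a <= t <= b -> exists2 d, is_derive t 1 x d & d <= C} ->
  x b - x a <= C * (b - a).
Proof.
move=> ab xac [N [mN muN subN]].
have [ab0|ab_gt0] := leP (b - a) 0.
  have -> : b = a by lra.
  by rewrite !subrr mulr0.
apply/ler_addgt0Pr => e' e'0.
pose e := e' / (2 + (b - a)).
have e0 : 0 < e by rewrite divr_gt0//; lra.
have ee : e * (2 + (b - a)) = e' by rewrite divfK//; lra.
pose c := C + e.
have [d d0 xd] := xac _ e0.
(* The steps inside U leave a gap of |c| times their length in the estimate with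
   speed c; the second term of the minimum makes it at most e. *)
pose d' := Num.min d (e / (`|c| + 1)).
have cp : 0 < `|c| + 1 by rewrite ltr_wpDl.
have d'0 : 0 < d' by rewrite lt_min d0 divr_gt0.
have [U [oU NU mU]] : exists U : set R,
    [/\ open U, N `<=` U & (mu U < d'%:E)%E].
  have [|U [oU NU mU]] := lebesgue_regularity_outer mN _ d'0.
    apply: le_lt_trans (ltry 0); rewrite le_eqVlt.
    by apply/orP; left; apply/eqP; exact: muN.
  exists U; split=> //; rewrite -(setDUK NU) measureU//=.
  - apply: le_lt_trans mU; rewrite -[leRHS]add0e leeD2r// le_eqVlt.
    by apply/orP; left; apply/eqP; exact: muN.
  - by apply: measurableD => //; exact: open_measurable.
  - by rewrite setDIK.
pose good s t := x t - x s <= c * (t - s).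
pose step s t := (s <= t) && `[< good s t \/ `]s, t[%classic `<=` U >].
have [l [sl lb]] : exists l, path step a l /\ last a l = b.
  pose Q s t := exists l, path step s l /\ last s l = t.
  apply: (@additive_segment_ind Q) => //.
    move=> s t u [l [sl <-]] [k [sk <-]]; exists (l ++ k).
    by rewrite cat_path last_cat sl sk.
  move=> t tab; have [Ut|nUt] := pselect (U t).
    have [r /= r0 rU] := (nbhs_ballP _ _).1 (open_nbhs_nbhs (conj oU Ut)).
    exists r => // s u as_ st tu ub usr; exists [:: u]; split=> //=.
    rewrite andbT /step (le_trans st tu)/=; apply/asboolP; right => z /=.
    rewrite in_itv/= => /andP[sz zu]; apply: rU; rewrite /ball/= ltr_norml.
    by apply/andP; split; lra.
  have [D xD DC] : exists2 D, is_derive t 1 x D & D <= C.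
    apply: contrapT => H; apply: nUt; apply/NU/subN => /= H'; apply: H.
    exact: H'.
  have [r r0 H] := is_derive_straddle xD e0.
  exists r => // s u as_ st tu ub usr; exists [:: u]; split=> //=.
  rewrite andbT /step (le_trans st tu)/=; apply/asboolP; left.
  rewrite /good (le_trans (H _ _ st tu usr))// ler_wpM2r//.
    by rewrite subr_ge0 (le_trans st).
  by rewrite /c lerD2r.
pose n := size l; pose S i := nth a (a :: l) i.
have Sstep i : (i < n)%N -> step (S i) (S i.+1) by move/(pathP a): sl; exact.
have Smono i j : (i <= j)%N -> (j <= n)%N -> S i <= S j.
  elim: j => [|j IH]; first by rewrite leqn0 => /eqP ->.
  rewrite leq_eqVlt => /predU1P[->//|ij] jn.
  by rewrite (le_trans (IH _ (ltnW jn)))//; have /andP[] := Sstep _ jn.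
have S0 : S 0%N = a by [].
have Sn : S n = b by rewrite /S /n -lb -[RHS](nth_last a (a :: l)).
(* Keep all the steps and collapse the good ones to empty intervals, so that
   the definition of absolute continuity applies to one family on the ordinal
   type of n. *)
pose v i := if `[< good (S i) (S i.+1) >] then S i else S i.+1.
have vP i : (i < n)%N ->
    [/\ S i <= v i, v i <= S i.+1 & `]S i, v i[%classic `<=` U].
  move=> /Sstep /andP[SS /asboolP gU]; rewrite /v; case: asboolP => [_|].
    by split=> // z /=; rewrite in_itv/= => /andP[? ?]; exfalso; lra.
  by case: gU.
have triv : trivIset [set: 'I_n] (fun i : 'I_n => [set` `]S i, v i[]).
  apply/trivIsetP => i j _ _.
  wlog ij : i j / (i < j)%N.
    move=> W ij; have [/W|] := ltnP i j; first exact.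
    rewrite leq_eqVlt => /predU1P[/val_inj E|/W]; first by rewrite E eqxx in ij.
    by rewrite setIC; apply; rewrite eq_sym.
  move=> _; rewrite -subset0 => z /= [].
  rewrite !in_itv/= => /andP[_ zi] /andP[jz _].
  have [_ vi _] := vP _ (ltn_ord i).
  by have := Smono _ _ ij (ltnW (ltn_ord j)); lra.
have vsum : \sum_(i < n) (v i - S i) < d'.
  rewrite -lte_fin; apply: le_lt_trans mU.
  have Fm (k : 'I_n) : measurable [set` `]S k, v k[] by [].
  have Um : measurable (\big[setU/set0]_(k < n) [set` `]S k, v k[]).
    exact: bigsetU_measurable.
  apply: (@le_trans _ _ (mu (\big[setU/set0]_(k < n) [set` `]S k, v k[]))).
    rewrite measure_semi_additive_ord// -sumEFin lee_sum// => i _.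
    suff : ((v i - S i)%:E <= mu `]S i, v i[%classic)%E by [].
    rewrite lebesgue_measure_itv/= lte_fin.
    have [//|vi] := ltP (S i) (v i).
    have [Si _ _] := vP _ (ltn_ord i).
    by have -> : v i - S i = 0 by lra.
  apply: le_measure; rewrite ?inE//; first exact: open_measurable.
  apply: (big_ind (fun A => A `<=` U)) => [//|A B AU BU|i _].
    by rewrite subUset.
  by have [] := vP _ (ltn_ord i).
have xsum : \sum_(i < n) `|x (v i) - x (S i)| < e.
  apply: xd => //; last by rewrite (lt_le_trans vsum)// ge_min lexx.
  move=> i; have [Si vi _] := vP _ (ltn_ord i).
  have aS : a <= S i by rewrite -[leLHS]S0 Smono// ltnW.
  have Sb : S i.+1 <= b by rewrite -[leRHS]Sn Smono.
  by split=> //; split=> //; exact: le_trans Sb.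
have tele (f : R -> R) : f b - f a = \sum_(i < n) (f (S i.+1) - f (S i)).
  by rewrite -(big_mkord xpredT (fun i => f (S i.+1) - f (S i)))
    (@telescope_sumr _ _ _ (f \o S))//= S0 Sn.
have main : x b - x a <= c * (b - a)
    + (\sum_(i < n) `|x (v i) - x (S i)| + `|c| * \sum_(i < n) (v i - S i)).
  rewrite (tele x) (tele id) !mulr_sumr -!big_split/=; apply: ler_sum => i _.
  have /andP[SS /asboolP _] := Sstep _ (ltn_ord i).
  rewrite /v; case: asboolP => [g|_].
    by rewrite !subrr normr0 mulr0 !addr0.
  rewrite addrCA -mulrDl -[leLHS]addr0 lerD ?ler_norm// mulr_ge0 ?subr_ge0//.
  by have := ler_norm (- c); rewrite normrN; lra.
have : `|c| * \sum_(i < n) (v i - S i) <= e.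
  apply: (@le_trans _ _ (`|c| * (e / (`|c| + 1)))).
    by rewrite ler_wpM2l// (le_trans (ltW vsum))// ge_min lexx orbT.
  by rewrite mulrA ler_pdivrMr//; nra.
by move: main ee xsum; rewrite /c; nra.
Qed.

End monotonicity.

(** * Lipschitz functions that cannot keep decreasing *)

Section lipschitz.
Context {R : realType}.
Notation mu := (@lebesgue_measure R).
Implicit Types (w : R -> R) (a b c L d : R).

Definition lipschitz_by L w := forall s t, `|w t - w s| <= L * `|t - s|.

Lemma lipschitz_by_ge0 L w : lipschitz_by L w -> 0 <= L.
Proof.
move=> /(_ 0 1); rewrite subr0 normr1 mulr1; exact: le_trans.
Qed.

Lemma lipschitz_byN L w : lipschitz_by L w -> lipschitz_by L (fun t => - w t).
Proof. by move=> wL s t; rewrite -opprD normrN. Qed.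

Lemma lipschitz_byB L L' w w' : lipschitz_by L w -> lipschitz_by L' w' ->
  lipschitz_by (L + L') (fun t => w t - w' t).
Proof.
move=> wL wL' s t; rewrite mulrDl.
rewrite (_ : _ + _ = (w t - w s) - (w' t - w' s)); last by ring.
by rewrite (le_trans (ler_normB _ _))// lerD.
Qed.

Lemma lipschitz_by_abs_continuous L w a b :
  lipschitz_by L w -> abs_continuous_on a b w.
Proof.
move=> wL e e0; have L0 := lipschitz_by_ge0 wL.
exists (e / (L + 1)) => [|n u v uv _ sd]; first by rewrite divr_gt0 ?ltr_wpDl.
apply: (@le_lt_trans _ _ (L * \sum_(i < n) (v i - u i))).
  rewrite mulr_sumr; apply: ler_sum => i _; rewrite (le_trans (wL _ _))//.
  by rewrite ger0_norm// subr_ge0; have [_ []] := uv i.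
move: sd; rewrite ltr_pdivlMr ?ltr_wpDl// mulrDr mulr1 mulrC.
apply: le_lt_trans; rewrite lerDl; apply: sumr_ge0 => i _.
by rewrite subr_ge0; have [_ []] := uv i.
Qed.

Lemma lipschitz_by_continuous L w : lipschitz_by L w -> continuous w.
Proof.
move=> wL t; have L0 := lipschitz_by_ge0 wL.
apply/cvgrPdist_lt => e e0; near=> s.
rewrite distrC (le_lt_trans (wL _ _))//.
have : `|s - t| < e / (L + 1).
  by near: s; apply: cvgr_distC_lt => //; rewrite divr_gt0// ltr_wpDl.
rewrite ltr_pdivlMr ?ltr_wpDl// mulrDr mulr1 mulrC; apply: le_lt_trans.
by rewrite lerDl.
Unshelve. all: by end_near. Qed.

Lemma lipschitz_by_measurable L w : lipschitz_by L w -> measurable_fun setT w.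
Proof. by move/lipschitz_by_continuous/continuous_measurable_fun. Qed.

Lemma ae_derive_le_oo w a b C : a <= b -> abs_continuous_on a b w ->
  {ae mu, forall t, a < t < b -> exists2 d, is_derive t 1 w d & d <= C} ->
  w b - w a <= C * (b - a).
Proof.
move=> ab wac H; apply: ae_derive_le => //.
have ne c : {ae mu, forall t, t != c}.
  exists [set c]%classic; split => //; first exact: lebesgue_measure_set1.
  by move=> t /= /negP; rewrite negbK => /eqP.
have aeF := ae_filter_ringOfSetsType mu.
apply: filterS3 H (ne a) (ne b) => t H ta tb /andP[at_ tb_]; apply: H.
by rewrite !lt_neqAle eq_sym ta tb at_.
Qed.

(** Start close to the supremum of [w] and go backwards: by the Lipschitz bound
[w] remains above [c] on a segment of fixed length [h], on which it decreases at
speed [d], so at the beginning of that segment it exceeded its supremum. *)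
Lemma escape_le w L B c d : lipschitz_by L w -> (forall t, w t <= B) -> 0 < d ->
  (forall a b, a < b -> (forall t, a < t < b -> c < w t) ->
    w b - w a <= - d * (b - a)) ->
  forall t, w t <= c.
Proof.
move=> wL wB d0 wd t0; rewrite leNgt; apply/negP => ct0.
pose E := range w.
have Esup : has_sup E by split; [exists (w t0), t0|exists B => _ [t _ <-]].
have Eub t : w t <= sup E by apply: (sup_upper_bound Esup); exists t.
have cs := lt_le_trans ct0 (Eub t0).
have L0 := lipschitz_by_ge0 wL.
pose h := (sup E - c) / (2 * (L + 1)).
have h0 : 0 < h by rewrite divr_gt0; lra.
have hE : h * (2 * (L + 1)) = sup E - c by rewrite divfK//; lra.
have m0 : 0 < Num.min h (d * h) by rewrite lt_min h0 mulr_gt0.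
have [_ [t1 _ <-]] := sup_adherent m0 Esup.
rewrite ltrBlDr -ltrBlDl lt_min => /andP[t1h t1d].
have /wd : t1 - h < t1 by lra.
suff H t : t1 - h < t < t1 -> c < w t.
  by move=> /(_ H); have := Eub (t1 - h); lra.
move=> /andP[ht tt1]; have := wL t1 t; rewrite distrC.
rewrite [`|t - t1|]ltr0_norm ?subr_lt0// => /ler_normlP[_].
have : L * (t1 - t) <= L * h by rewrite ler_wpM2l//; lra.
by rewrite opprB; nra.
Qed.

(** The mirror image of [escape_le], through [t |-> - w (- t)]: the function
would fall below its infimum in the future. *)
Lemma escape_ge w L B c d : lipschitz_by L w -> (forall t, B <= w t) -> 0 < d ->
  (forall a b, a < b -> (forall t, a < t < b -> w t < c) ->
    w b - w a <= - d * (b - a)) ->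
  forall t, c <= w t.
Proof.
move=> wL wB d0 wd t; rewrite -[t]opprK -lerN2.
apply: (@escape_le (fun t => - w (- t)) L (- B) (- c) d) => //.
- move=> s u; rewrite (le_trans (lipschitz_byN wL _ _))//.
  by rewrite -opprD normrN.
- by move=> s; rewrite lerN2.
- move=> a b ab H; have := @wd (- b) (- a); rewrite ltrN2 => /(_ ab) wba.
  suff : w (- a) - w (- b) <= - d * (- a - - b) by lra.
  apply: wba => s /andP[bs sa]; have := H (- s); rewrite opprK ltrN2; apply.
  by rewrite ltrNr sa ltrNl.
Qed.

End lipschitz.

(** * Exponentially weighted averages over the past *)

Section past_average.
Context {R : realType}.
Notation mu := (@lebesgue_measure R).
Variable M : R.
Hypothesis M0 : 0 < M.
Implicit Types (g h : R -> R) (t B : R).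

Let E t : R := expR (M * t).
Let W t : R := M * E t.

(** The mean of [g] over the past with weight [M e^(- M (t - r)) dr], a
probability density on [r <= t]; for bounded [g] it is, as a function of [t], the
bounded solution of [y' = M (g - y)]. *)
Definition past_average g t : R :=
  expR (- (M * t)) * \int[mu]_(r in `]-oo, t]) (M * expR (M * r) * g r).

Let E_gt0 t : 0 < E t. Proof. exact: expR_gt0. Qed.

Let W_ge0 t : 0 <= W t. Proof. by rewrite mulr_ge0 ?ltW. Qed.

Let is_derive_E t : is_derive t 1 E (W t).
Proof.
have d1 : is_derive t 1 (fun r => M * r) M.
  apply: is_derive_eq; rewrite /GRing.scale/=; ring.
by have := is_derive1_comp (is_derive_expR (M * t)) d1; rewrite mulrC.
Qed.

Let continuous_E : continuous E.
Proof.
by move=> t; apply: differentiable_continuous; apply/derivable1_diffP.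
Qed.

Let continuous_W : continuous W.
Proof. by move=> t; apply: cvgM; [exact: cvg_cst|exact: continuous_E]. Qed.

(* The reflection moves the improper end of the integral to +oo, where the
   primitive is - expR (- M r) and tends to 0. *)
Let integral_W t : (\int[mu]_(r in `]-oo, t]) (W r)%:E = (E t)%:E)%E.
Proof.
rewrite -[t in LHS]opprK ge0_integration_by_substitutionNy; last 2 first.
- exact: continuous_subspaceT.
- by move=> r _; exact: W_ge0.
have dN (r : R) : is_derive r 1 (fun r => - E (- r)) (W (- r)).
  have d1 : is_derive r 1 (fun r : R => - r) (- 1) by exact: is_deriveN.
  have := is_deriveN (is_derive1_comp (is_derive_E (- r)) d1).
  by rewrite mulrN1 opprK.
rewrite (@ge0_continuous_FTC2y R _ (fun r => - E (- r)) (- t) 0).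
- by rewrite -EFinB sub0r !opprK.
- by move=> r _; exact: W_ge0.
- apply: continuous_subspaceT => r.
  apply: continuous_comp; last exact: continuous_W.
  exact: oppr_continuous.
- rewrite -oppr0; apply: cvgN.
  under eq_fun do rewrite /E mulrN.
  apply: (@cvg_comp _ _ _ (fun r => M * r) (fun r => expR (- r)) _ +oo) _
    (@cvgr_expR R).
  by apply: gt0_cvgMry => //; exact: cvg_id.
- by move=> r _; exact: ex_derive.
- apply: cvg_at_right_filter.
  have cN : continuous (fun r => - E (- r)).
    by move=> r; apply: differentiable_continuous; apply/derivable1_diffP.
  exact: cN.
- by move=> r _; rewrite derive1E; exact: derive_val.
Qed.

Let integrable_W t : mu.-integrable `]-oo, t] (EFin \o W).
Proof.
apply/integrableP; split.
  apply/measurable_EFinP; apply: measurable_funTS.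
  exact: continuous_measurable_fun.
under eq_integral do rewrite /= ger0_norm//.
by rewrite integral_W ltry.
Qed.

Let Rintegral_W t : \int[mu]_(r in `]-oo, t]) W r = E t.
Proof. by rewrite /Rintegral integral_W. Qed.

Let measurable_Wg g :
  measurable_fun setT g -> measurable_fun setT (fun r => W r * g r).
Proof.
by move=> mg; apply: measurable_funM => //; exact: continuous_measurable_fun.
Qed.

Let integrable_WB B t : mu.-integrable `]-oo, t] (fun r => (W r * B)%:E).
Proof.
have -> : (fun r => (W r * B)%:E) = (fun r => (B%:E * (W r)%:E)%E).
  by apply/funext => r; rewrite mulrC EFinM.
exact: integrableZl.
Qed.

Let integrable_Wg g B t : measurable_fun setT g -> (forall r, `|g r| <= B) ->
  mu.-integrable `]-oo, t] (EFin \o (fun r => W r * g r)).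
Proof.
move=> mg gB.
apply: (@le_integrable _ _ _ mu _ _ _ (fun r => (W r * B)%:E)) => //.
- by apply/measurable_EFinP/measurable_funTS; exact: measurable_Wg.
- move=> r _; rewrite lee_fin !normrM ler_wpM2l// (le_trans (gB r))//.
  exact: ler_norm.
Qed.

Lemma le_past_average g h B B' t :
  measurable_fun setT g -> (forall r, `|g r| <= B) ->
  measurable_fun setT h -> (forall r, `|h r| <= B') ->
  (forall r, g r <= h r) -> past_average g t <= past_average h t.
Proof.
move=> mg gB mh hB gh; rewrite ler_wpM2l ?expR_ge0//; apply: le_Rintegral => //.
- exact (integrable_Wg t mg gB).
- exact (integrable_Wg t mh hB).
- by move=> r _; rewrite (ler_wpM2l (W_ge0 r)).
Qed.

Lemma past_average_cst B t : past_average (cst B) t = B.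
Proof.
rewrite /past_average RintegralZr// Rintegral_W mulrA -expRD addNr expR0.
exact: mul1r.
Qed.

Lemma past_average_norm_le g B t :
  measurable_fun setT g -> (forall r, `|g r| <= B) -> `|past_average g t| <= B.
Proof.
move=> mg gB.
have cB (c : R) : forall r : R, `|cst c r| <= `|c| by [].
have mc (c : R) : measurable_fun [set: R] (cst c) by [].
rewrite ler_norml -{1}(past_average_cst (- B) t) -{2}(past_average_cst B t).
have gBB r : - B <= g r <= B by rewrite -ler_norml.
rewrite (le_past_average _ (mc _) (cB _) mg gB) => [|r]; last first.
  by case/andP: (gBB r).
by apply: (le_past_average _ mg gB (mc _) (cB _)) => r; case/andP: (gBB r).
Qed.

(** Dominated convergence, with the weight times [B] as dominating function. *)
Lemma past_average_cvg (g_ : (R -> R)^nat) g B t :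
  (forall n, measurable_fun setT (g_ n)) -> (forall n r, `|g_ n r| <= B) ->
  (forall r, g_ ^~ r @ \oo --> g r) ->
  past_average (g_ n) t @[n --> \oo] --> past_average g t.
Proof.
move=> mg_ g_B g_g.
have mg : measurable_fun setT g.
  by apply: measurable_fun_cvg => // r _; exact: g_g.
apply: cvgM; first exact: cvg_cst.
have mI : measurable `]-oo, t]%classic by [].
have H := @dominated_convergence _ _ R mu _ mI (fun n r => (W r * g_ n r)%:E)
  (fun r => (W r * g r)%:E) (fun r => (W r * B)%:E).
have [|||||iWg _ +] := H _ _ _ _ _.
- by move=> n; apply/measurable_EFinP/measurable_funTS; exact: measurable_Wg.
- by apply/measurable_EFinP/measurable_funTS; exact: measurable_Wg.
- apply: aeW => r _; apply: cvg_EFin; first exact: nearW.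
  by apply: cvgM; [exact: cvg_cst|exact: g_g].
- exact: integrable_WB.
- apply: aeW => r n _; rewrite lee_fin normrM (ger0_norm (W_ge0 r)).
  exact: ler_wpM2l.
- move=> Ig_cvg; apply: fine_cvg; rewrite /Rintegral fineK; first exact: Ig_cvg.
  exact: integrable_fin_num.
Qed.

(** Between [s] and [t] the integral gains at most [B] times the new mass, and
the renormalisation of the old part loses at most the same amount; the new mass
is at most [1 - e^(- M (t - s)) <= M (t - s)]. *)
Lemma past_average_lipschitz g B :
  measurable_fun setT g -> (forall r, `|g r| <= B) ->
  lipschitz_by (2 * B * M) (past_average g).
Proof.
move=> mg gB s t; wlog st : s t / s <= t.
  move=> H; case: (leP s t) => [/H//|/ltW/H].
  by rewrite distrC [`|s - t|]distrC.
have B0 : 0 <= B by exact: le_trans (gB 0).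
pose I u := \int[mu]_(r in `]-oo, u]) (W r * g r).
have mst : measurable `]s, t]%classic by [].
have sub : `]s, t]%classic `<=` `]-oo, t]%classic.
  by move=> r /=; rewrite !in_itv/= => /andP[].
have iWg := integrable_Wg t mg gB.
have IE : I t - I s = \int[mu]_(r in `]s, t]) (W r * g r).
  exact: (@Rintegral_itvB _ (fun r => W r * g r) -oo%O (BRight t) s).
have EE : E t - E s = \int[mu]_(r in `]s, t]) W r.
  rewrite -2!Rintegral_W.
  exact: (@Rintegral_itvB _ W -oo%O (BRight t) s (integrable_W t)).
have Iincr : `|I t - I s| <= (E t - E s) * B.
  rewrite IE EE -RintegralZr//; last first.
    exact: integrableS (integrable_W t).
  have iWg' : mu.-integrable `]s, t] (EFin \o (fun r => W r * g r)).
    exact: integrableS iWg.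
  apply: le_trans (le_normr_Rintegral _ iWg') _ => //.
  apply: le_Rintegral => //.
  - exact: (integrable_norm iWg').
  - exact: integrableS (integrable_WB B t).
  - by move=> r _; rewrite normrM ger0_norm// ler_wpM2l.
have IP u : I u = E u * past_average g u.
  by rewrite /past_average mulrA -expRD subrr expR0 mul1r.
rewrite [`|t - s|]ger0_norm ?subr_ge0//.
rewrite -(ler_pM2l (E_gt0 t)) -[X in X * `|_|](gtr0_norm (E_gt0 t)) -normrM.
have -> : E t * (past_average g t - past_average g s) =
  (I t - I s) - (E t - E s) * past_average g s by rewrite !IP; ring.
rewrite (le_trans (ler_normB _ _))//.
have Est : E s <= E t by rewrite ler_expR ler_pM2l.
have : `|(E t - E s) * past_average g s| <= (E t - E s) * B.
  rewrite normrM ger0_norm ?subr_ge0// ler_wpM2l ?subr_ge0//.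
  exact: past_average_norm_le.
have : E t - E s <= E t * (M * (t - s)).
  have -> : E s = E t * expR (- (M * (t - s))).
    by rewrite -expRD; congr expR; ring.
  rewrite -[X in X - _]mulr1 -mulrBr ler_pM2l// lerBlDl -lerBlDr.
  exact: expR_ge1Dx.
move=> /(ler_wpM2r B0); lra.
Qed.

Let locally_integrable_Wg g B : measurable_fun setT g ->
  (forall r, `|g r| <= B) -> locally_integrable setT (fun r => W r * g r).
Proof.
move=> mg gB; split; [exact: measurable_Wg|exact: openT|move=> K _ cK].
have [y [_ Ky]] := compact_bounded cK.
have Kle : K `<=` `]-oo, y + 1]%classic.
  move=> r Kr; rewrite /= in_itv/= (le_trans (ler_norm _))//.
  by apply: Ky => //; rewrite ltrDl.
have /integrableP[mf] := integrable_Wg (y + 1) mg gB.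
apply: le_lt_trans; apply: ge0_subset_integral => //.
  exact: compact_measurable.
apply/measurable_EFinP; apply: measurableT_comp => //.
by apply: measurable_funTS; exact: measurable_Wg.
Qed.

Lemma past_average_derive g B :
  measurable_fun setT g -> (forall r, `|g r| <= B) ->
  {ae mu, forall t,
    is_derive t 1 (past_average g) (M * (g t - past_average g t))}.
Proof.
move=> mg gB.
have iWg y := integrable_Wg y mg gB.
have aeF := ae_filter_ringOfSetsType mu.
apply: filterS (FTC1Ny iWg (locally_integrable_Wg mg gB)) => t [dI IE].
set I := (fun x => _) in dI IE.
have d1 : is_derive t 1 (fun r => - (M * r)) (- M).
  by apply: is_derive_eq; rewrite /GRing.scale/=; ring.
have d2 := @is_derive1_comp _ expR (fun r => - (M * r)) t _ _
  (is_derive_expR _) d1.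
have d3 : is_derive t 1 I (W t * g t).
  by rewrite -IE derive1E; exact: derivableP.
have := is_deriveM d2 d3.
have -> : (expR \o (fun r => - (M * r))) * I = past_average g by [].
move=> d4; apply: is_derive_eq; rewrite /GRing.scale/=.
have -> : W t * g t = M * g t * E t by rewrite /W; ring.
rewrite [X in X + _](_ : _ = M * g t); last first.
  by rewrite mulrCA -expRD addNr expR0 mulr1.
by rewrite /past_average -[X in g t - _ * X]/(I t); ring.
Qed.

End past_average.

(** * Measurability of right-continuous functions *)

Section measurability.
Context {R : realType}.

(** A right-continuous function is the limit of its step approximations that
use the right end point of each cell of a grid. *)
Lemma right_continuous_measurable (q : R -> R) :
  (forall t, q @ at_right t --> q t) -> measurable_fun setT q.
Proof.
move=> qr.
pose q_ n (t : R) := q (((Num.floor (n.+1%:R * t) + 1)%:~R) / n.+1%:R).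
apply: (@measurable_fun_cvg _ _ _ _ q_) => [n|t _].
  have n0 : (0 : R) < n.+1%:R by [].
  move=> _ Y mY; rewrite setTI.
  pose I (k : int) : set R := [set` `[k%:~R / n.+1%:R, (k + 1)%:~R / n.+1%:R[].
  have -> : q_ n @^-1` Y = \bigcup_k
      (if `[< Y (q ((k + 1)%:~R / n.+1%:R)) >] then I k else set0).
    apply/seteqP; split=> [t Yt|t [k _]].
      exists (Num.floor (n.+1%:R * t)) => //.
      rewrite (introT (asboolP _)) // /I/= in_itv/=.
      rewrite ler_pdivrMr// ltr_pdivlMr// [t * _]mulrC.
      by rewrite floor_le floorD1_gt.
    case: asboolP => // Yk; rewrite /I/= in_itv/= => kt; rewrite /q_.
    have -> // : Num.floor (n.+1%:R * t) = k.
    apply/floor_def; rewrite mulrC.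
    by rewrite -ler_pdivrMr// -ltr_pdivlMr.
  apply: countable_bigcupT_measurable => [|k]; first exact: countableP.
  case: ifP => // _.
  exact: measurable_itv.
have tn n : t < (Num.floor (n.+1%:R * t) + 1)%:~R / n.+1%:R.
  by rewrite ltr_pdivlMr// mulrC floorD1_gt.
apply: (cvg_at_rightP _ _ _).1 => //; split=> //.
apply/cvgrPdist_le => e e0.
near=> n.
rewrite distrC ger0_norm ?subr_ge0 ?(ltW (tn n))//.
apply: (@le_trans _ _ (harmonic n)).
  rewrite /harmonic/= lerBlDl ler_pdivrMr// mulrDl mulVf//.
  by rewrite intrD lerD2r mulrC floor_le.
by near: n; have /cvgrPdist_le/(_ e e0) := @cvg_harmonic R; apply: filterS => n;
  rewrite sub0r normrN; exact: le_trans (ler_norm _).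
Unshelve. all: by end_near. Qed.

End measurability.

(** * Existence of bounded solutions from subsolutions *)

Section riccati.
Context {R : realType}.
Notation mu := (@lebesgue_measure R).
Implicit Types (q p b v g : R -> R) (k l K t y B : R).

(** With [A] the past average of [g], the difference [b - A] satisfies
[(b - A)' <= - M (b - A)] almost everywhere and is bounded above, so by [escape_le] it
cannot exceed any [c > 0]. *)
Lemma le_past_average_of_subsolution (M : R) b L K g B : 0 < M ->
  lipschitz_by L b -> (forall t, b t <= K) ->
  measurable_fun setT g -> (forall t, `|g t| <= B) ->
  {ae mu, forall t, exists2 d, is_derive t 1 b d & d <= M * (g t - b t)} ->
  forall t, b t <= past_average M g t.
Proof.
move=> M0 bL bK mg gB bg t; rewrite -subr_le0; apply/ler_addgt0Pr => c c0.
rewrite add0r; set A := past_average M g.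
have wL := lipschitz_byB bL (past_average_lipschitz M0 mg gB).
apply: (@escape_le _ (fun t => b t - A t) _ (K + B) c (M * c) wL) => //.
- move=> s; rewrite lerD// lerNl.
  by have := past_average_norm_le M0 s mg gB; rewrite ler_norml => /andP[].
- by rewrite mulr_gt0.
move=> s u su wc.
apply: (@ae_derive_le_oo _ (fun t => b t - A t)); first exact: ltW.
  exact: lipschitz_by_abs_continuous wL.
have aeF := ae_filter_ringOfSetsType mu.
apply: filterS2 bg (past_average_derive M0 mg gB) => r [d bd dle] Ad /wc cw.
exists (d - M * (g r - A r)); first exact: is_deriveB.
have : M * c <= M * (b r - A r) by rewrite ler_wpM2l ?ltW.
lra.
Qed.

Definition riccati q p l t y : R := - y ^+ 2 + q t * y + p t + l.

Definition subsolution q p l b := {ae mu, forall t,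
  exists2 d, is_derive t 1 b d & d <= riccati q p l t (b t)}.

Section existence.
Variables (q p : R -> R) (k l K : R).
Hypotheses (mq : measurable_fun setT q) (mp : measurable_fun setT p).
Hypotheses (qk : forall t, `|q t| <= k) (pk : forall t, `|p t| <= k).
(* That is, K >= k + |m| + 2 for all the parameters m in [l, l + 1]. *)
Hypothesis kK : k + `|l| + 3 <= K.

(* M dominates minus the slope of [riccati] in y on [-K, K]; this makes [Phi]
   monotone there. *)
Let M := 2 * K + k + 1.
Let ln n := l + harmonic n.
Let Phi m v t := v t + riccati q p m t (v t) / M.

Let k0 : 0 <= k. Proof. exact: le_trans (qk 0). Qed.
Let K3 : 3 <= K. Proof. by have := normr_ge0 l; move: kK k0; lra. Qed.
Let M0 : 0 < M. Proof. by rewrite /M; move: K3 k0; lra. Qed.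

Let B := K + (K ^+ 2 + k * K + k + `|l| + 1) / M.

Let lnP n : l <= ln n <= l + 1.
Proof.
rewrite lerDl lerD2l ltW ?harmonic_gt0//= invf_le1//.
by rewrite ler1n.
Qed.

Let ln_nincr n m : (n <= m)%N -> ln m <= ln n.
Proof. by move=> nm; rewrite lerD2l /= lef_pV2 ?posrE// ler_nat. Qed.

Let Phi_homo m m' v w t : m <= m' -> - K <= v t -> v t <= w t -> w t <= K ->
  Phi m v t <= Phi m' w t.
Proof.
move=> mm Kv vw wK; rewrite -(ler_pM2l M0) !mulrDr ![M * (_ / _)]mulrC.
rewrite !divfK ?gt_eqF// /riccati /M -subr_ge0.
have := qk t; rewrite ler_norml => /andP[q1 q2].
rewrite (_ : _ - _ = (w t - v t) * ((K - w t) + (K - v t) + (k + q t) + 1)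
  + (m' - m)); last by ring.
by rewrite addr_ge0 ?subr_ge0// mulr_ge0 ?subr_ge0//; lra.
Qed.

Let Phi_norm m v t : l <= m <= l + 1 -> `|v t| <= K -> `|Phi m v t| <= B.
Proof.
move=> /andP[lm ml] vK; rewrite (le_trans (ler_normD _ _))// lerD//.
rewrite normrM normfV (gtr0_norm M0) ler_pM2r ?invr_gt0//.
have mn : `|m| <= `|l| + 1.
  by have := ler_norm l; have := ler_norm (- l); rewrite normrN ler_norml; lra.
rewrite /riccati -!addrA 3?(le_trans (ler_normD _ _))// lerD//.
  by rewrite normrN normrX ler_pXn2r// nnegrE// (le_trans _ K3).
rewrite (le_trans (ler_normD _ _))// lerD//.
  by rewrite normrM ler_pM.
by rewrite (le_trans (ler_normD _ _))// lerD.
Qed.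

Let Phi_measurable m v : measurable_fun setT v -> measurable_fun setT (Phi m v).
Proof.
move=> mv; apply: measurable_funD => //; apply: measurable_funM => //.
apply: measurable_funD => //; apply: measurable_funD => //.
apply: measurable_funD; last exact: measurable_funM.
apply: measurableT_comp => //; exact: measurable_funX.
Qed.

(* The constant K is a supersolution for all the parameters in [l, l + 1]. *)
Let Phi_K m t : l <= m <= l + 1 -> Phi m (cst K) t <= K.
Proof.
move=> /andP[_ ml]; rewrite gerDl pmulr_lle0 ?invr_gt0// /riccati /cst.
have := qk t; have := pk t; rewrite !ler_norml => /andP[_ p2] /andP[_ q2].
have := ler_norm l; have := normr_ge0 l.
have K0 : 0 <= K by move: K3; lra.
have qK : q t * K <= k * K by rewrite ler_wpM2r.
have kKK : (k + `|l| + 3) * K <= K * K by rewrite ler_wpM2r.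
have lK : `|l| <= `|l| * K by rewrite ler_peMr//; move: K3; lra.
by rewrite expr2; move: K3 kK k0; lra.
Qed.

(* The parameter l + 1/(n+1) changes with the step, so that the single limit
   n -> oo both solves the equation and reaches the parameter l. *)
Let v n : R -> R := iteri n (fun i w => past_average M (Phi (ln i) w)) (cst K).

Hypothesis subs : forall n, exists b L, [/\ lipschitz_by L b,
  forall t, `|b t| <= K & subsolution q p (l + harmonic n) b].

(* Step n has only used parameters l + 1/(i+1) with i < n; when n <= m + 1 these
   are at least l + 1/(m+1), so the iterate is above the m-th subsolution. *)
Let v_inv n : [/\ measurable_fun setT (v n), forall t, v n t <= K &
  forall m b L, (n <= m.+1)%N -> lipschitz_by L b -> (forall t, `|b t| <= K) ->
    subsolution q p (ln m) b -> forall t, b t <= v n t].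
Proof.
elim: n => [|n [mv vK bv]].
  split=> // m b L _ _ bK _ t; exact: le_trans (ler_norm _) (bK t).
have Kv t : - K <= v n t.
  have [b [L [bL bK bs]]] := subs n.
  rewrite (le_trans _ (bv n b L (leqnSn n) bL bK bs t))//.
  by have := bK t; rewrite ler_norml => /andP[].
have vn t : `|v n t| <= K by rewrite ler_norml Kv vK.
have mPhi := Phi_measurable (ln n) mv.
have PhiB t : `|Phi (ln n) (v n) t| <= B by exact: Phi_norm.
split.
- apply: lipschitz_by_measurable.
  exact: (past_average_lipschitz M0 mPhi PhiB).
- move=> t; rewrite -[leRHS](past_average_cst M0 K t).
  have mK : measurable_fun [set: R] (cst K) by [].
  have KB (r : R) : `|cst K r| <= `|K| by [].
  apply: (le_past_average M0 t mPhi PhiB mK KB) => r.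
  apply: le_trans (Phi_K r (lnP n)).
  by apply: Phi_homo.
- move=> m b L nm bL bK bs t /=.
  apply: (le_past_average_of_subsolution M0 bL _ mPhi PhiB) => [r|].
    exact: le_trans (ler_norm _) (bK r).
  have aeF := ae_filter_ringOfSetsType mu.
  apply: filterS (bs) => r [d bd dle]; exists d => //; apply: (le_trans dle).
  have bvr : b r <= v n r by apply: (bv m b L) => //; exact: ltnW.
  have Kb : - K <= b r by have := bK r; rewrite ler_norml => /andP[].
  have lnm : ln m <= ln n by exact: ln_nincr.
  have := Phi_homo lnm Kb bvr (vK r).
  by rewrite {1}/Phi -lerBrDl ler_pdivrMr// mulrC.
Qed.

Let v_bounded n t : `|v n t| <= K.
Proof.
have [_ vK bv] := v_inv n; have [b [L [bL bK bs]]] := subs n.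
rewrite ler_norml vK andbT (le_trans _ (bv n b L (leqnSn n) bL bK bs t))//.
by have := bK t; rewrite ler_norml => /andP[].
Qed.

Let v_nincr n t : v n.+1 t <= v n t.
Proof.
elim: n t => [|n IH] t; first by have [_ + _] := v_inv 1; exact.
have mv m : measurable_fun setT (v m) by have [] := v_inv m.
have PhiB m r : `|Phi (ln m) (v m) r| <= B by exact: Phi_norm.
have mPhi m := Phi_measurable (ln m) (mv m).
apply: (le_past_average M0 t (mPhi n.+1) (PhiB n.+1) (mPhi n) (PhiB n)) => r.
have := v_bounded n.+1 r; have := v_bounded n r.
rewrite !ler_norml => /andP[_ vK] /andP[Kv _].
by apply: Phi_homo => //; exact: ln_nincr.
Qed.

Let u t := limn (v ^~ t).

Let v_cvg t : v n t @[n --> \oo] --> u t.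
Proof.
apply: nonincreasing_is_cvgn.
  by apply/nonincreasing_seqP => n; exact: v_nincr.
exists (- K) => _ [n _ <-].
by have := v_bounded n t; rewrite ler_norml => /andP[].
Qed.

Let u_bounded t : `|u t| <= K.
Proof.
rewrite ler_norml; apply/andP; split.
  apply: limr_ge; first exact: v_cvg.
  by apply: nearW => n; have := v_bounded n t; rewrite ler_norml => /andP[].
apply: limr_le; first exact: v_cvg.
by apply: nearW => n; have := v_bounded n t; rewrite ler_norml => /andP[].
Qed.

Let u_measurable : measurable_fun setT u.
Proof.
apply: (@measurable_fun_cvg _ _ _ _ v) => [n|t _]; last exact: v_cvg.
by have [] := v_inv n.
Qed.

Let ll : l <= l <= l + 1. Proof. by rewrite lexx lerDl ler01. Qed.

Let u_fixpoint t : u t = past_average M (Phi l u) t.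
Proof.
have mPhi n : measurable_fun setT (Phi (ln n) (v n)).
  by apply: Phi_measurable; have [] := v_inv n.
have PhiB n r : `|Phi (ln n) (v n) r| <= B by exact: Phi_norm.
have Phi_cvg r : Phi (ln n) (v n) r @[n --> \oo] --> Phi l u r.
  have vr := @v_cvg r.
  have lnl : ln n @[n --> \oo] --> l.
    rewrite -[X in _ --> X]addr0; apply: cvgD; first exact: cvg_cst.
    exact: cvg_harmonic.
  apply: cvgD => //; apply: cvgM; last exact: cvg_cst.
  apply: cvgD; last exact: lnl.
  apply: cvgD; last exact: cvg_cst.
  apply: cvgD; first by apply: cvgN; apply: cvgM.
  by apply: cvgM => //; exact: cvg_cst.
have vS : v n.+1 t @[n --> \oo] --> past_average M (Phi l u) t.
  exact: past_average_cvg mPhi PhiB Phi_cvg.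
have vt : v n.+1 t @[n --> \oo] --> u t.
  by rewrite (cvg_shiftS (v ^~ t)); exact: v_cvg.
exact: (cvg_unique _ vt vS).
Qed.

(** The existence principle: the fixed point [u] is bounded by [K], Lipschitz as
a past average, and its derivative [M (Phi u - u)] is [riccati] along [u]. *)
Lemma bounded_solution_of_subsolutions : has_bounded_solution q p l.
Proof.
have PhiB r : `|Phi l u r| <= B by exact: Phi_norm.
have mPhi := Phi_measurable l u_measurable.
have uE : u = past_average M (Phi l u) by apply/funext => t; exact: u_fixpoint.
exists u; split; last by exists K.
split=> [a b|].
  rewrite uE; apply: lipschitz_by_abs_continuous.
  exact: (past_average_lipschitz M0 mPhi PhiB).
have aeF := ae_filter_ringOfSetsType mu.
apply: filterS (past_average_derive M0 mPhi PhiB) => t.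
rewrite -uE /Phi [u t + _]addrC addrK mulrC divfK ?gt_eqF//.
Qed.

End existence.
End riccati.

(** * A priori bounds and the bifurcation value *)

Section bifurcation.
Context {R : realType}.
Notation mu := (@lebesgue_measure R).
Implicit Types (q p x : R -> R) (k l B K t y : R).

Lemma abs_continuous_onN a b x :
  abs_continuous_on a b x -> abs_continuous_on a b (fun t => - x t).
Proof.
move=> xac e /xac[d d0 H]; exists d => // n u v uv tr sd.
rewrite (le_lt_trans _ (H n u v uv tr sd))// ler_sum// => i _.
by rewrite -opprD normrN.
Qed.

Lemma ae_derive_lipschitz x L : (forall a b, abs_continuous_on a b x) ->
  {ae mu, forall t, exists2 d, is_derive t 1 x d & `|d| <= L} ->
  lipschitz_by L x.
Proof.
move=> xac xd s t; wlog st : s t / s <= t.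
  move=> H; case: (leP s t) => [/H//|/ltW/H].
  by rewrite distrC [`|s - t|]distrC.
have aeF := ae_filter_ringOfSetsType mu.
rewrite [`|t - s|]ger0_norm ?subr_ge0// ler_norml lerNl; apply/andP; split.
  rewrite opprB -[x s]opprK addrC.
  apply: (@ae_derive_le_oo _ (fun t => - x t)) => //.
    exact: abs_continuous_onN.
  apply: filterS xd => r [d xd dL] _; exists (- d); first exact: is_deriveN.
  by rewrite (le_trans (ler_norm _))// normrN.
apply: ae_derive_le_oo => //.
apply: filterS xd => r [d xd dL] _; exists d => //.
exact: le_trans (ler_norm _) dL.
Qed.

Definition bounded_solution q p l x :=
  caratheodory_solution (riccati q p l) x /\ exists B, forall t, `|x t| <= B.

Section a_priori.
Variables (q p : R -> R) (k l : R).
Hypotheses (qk : forall t, `|q t| <= k) (pk : forall t, `|p t| <= k).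

Let k0 : 0 <= k. Proof. exact: le_trans (qk 0). Qed.

Lemma riccati_norm_le B t y : `|y| <= B ->
  `|riccati q p l t y| <= B ^+ 2 + k * B + k + `|l|.
Proof.
move=> yB; have B0 := le_trans (normr_ge0 _) yB.
rewrite /riccati (le_trans (ler_normD _ _))// lerD//.
rewrite (le_trans (ler_normD _ _))// lerD//.
rewrite (le_trans (ler_normD _ _))// lerD//.
  by rewrite normrN normrX ler_pXn2r// nnegrE.
by rewrite normrM ler_pM.
Qed.

(** Far out the quadratic term wins; this is what the constant [k + |l| + 2]
is for. *)
Lemma riccati_le_N1 t y : k + `|l| + 2 <= `|y| -> riccati q p l t y <= - 1.
Proof.
move=> yk; have qy : q t * y <= k * `|y|.
  by rewrite (le_trans (ler_norm _))// normrM ler_wpM2r.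
have p2 := le_trans (ler_norm _) (pk t).
have l2 := ler_norm l; have l3 := normr_ge0 l.
have : (k + `|l| + 2) * `|y| <= y ^+ 2.
  by rewrite -[y ^+ 2]real_normK ?num_real// expr2 ler_wpM2r.
have : `|l| <= `|l| * `|y| by rewrite ler_peMr//; move: yk k0; lra.
by rewrite /riccati; move: yk k0; lra.
Qed.

Lemma bounded_solution_lipschitz x :
  bounded_solution q p l x -> exists L, lipschitz_by L x.
Proof.
move=> [[xac xd] [B xB]]; exists (B ^+ 2 + k * B + k + `|l|).
apply: ae_derive_lipschitz => //.
have aeF := ae_filter_ringOfSetsType mu.
apply: filterS xd => t xd; exists (riccati q p l t (x t)) => //.
exact: riccati_norm_le.
Qed.

(** A bounded solution cannot be where it decreases at speed 1: by [escape_le]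
it would come from arbitrarily high in the past, and by [escape_ge] it would go
arbitrarily low in the future. *)
Lemma bounded_solution_norm_le x :
  bounded_solution q p l x -> forall t, `|x t| <= k + `|l| + 2.
Proof.
move=> xsol; have [L xL] := bounded_solution_lipschitz xsol.
move: xsol => [[xac xd] [B xB]] t.
have aeF := ae_filter_ringOfSetsType mu.
have dec a b : a < b ->
    (forall r, a < r < b -> k + `|l| + 2 < `|x r|) ->
    x b - x a <= - 1 * (b - a).
  move=> ab xr; apply: ae_derive_le_oo => //; first exact: ltW.
  apply: filterS xd => r xd /xr xr'; exists (riccati q p l r (x r)) => //.
  exact: riccati_le_N1 (ltW xr').
rewrite ler_norml; apply/andP; split.
  apply: (@escape_ge _ x L (- B) _ 1 xL) => //.
    by move=> r; have := xB r; rewrite ler_norml => /andP[].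
  move=> a b ab xr; apply: dec => // r /xr.
  rewrite ltrNr => /lt_le_trans; apply.
  by rewrite -normrN ler_norm.
apply: (@escape_le _ x L B _ 1 xL) => //.
  by move=> r; exact: le_trans (ler_norm _) (xB r).
move=> a b ab xr; apply: dec => // r /xr /lt_le_trans; apply.
exact: ler_norm.
Qed.

(** For smaller [l] the right-hand side is negative and bounded away from 0
everywhere, hence [escape_le] applies at every level, even below the lower bound
of [x]. *)
Lemma bounded_solution_lambda_ge x :
  bounded_solution q p l x -> - k - k ^+ 2 <= l.
Proof.
move=> xsol; have [L xL] := bounded_solution_lipschitz xsol.
move: xsol => [[xac xd] [B xB]]; rewrite leNgt; apply/negP => lk.
have aeF := ae_filter_ringOfSetsType mu.
pose d := - k - k ^+ 2 - l; have d0 : 0 < d by rewrite subr_gt0.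
have : x 0 <= - B - 1.
  apply: (@escape_le _ x L B _ d xL) => //.
    by move=> r; exact: le_trans (ler_norm _) (xB r).
  move=> a b ab _; apply: ae_derive_le_oo => //; first exact: ltW.
  apply: filterS xd => r xd _; exists (riccati q p l r (x r)) => //.
  have q2 : q r ^+ 2 <= k ^+ 2.
    by rewrite -[q r ^+ 2]real_normK ?num_real// ler_pXn2r// nnegrE.
  have p2 := le_trans (ler_norm _) (pk r).
  have := sqr_ge0 (q r - x r); have := sqr_ge0 (x r); have := sqr_ge0 (q r).
  by rewrite /riccati /d; rewrite sqrrB; nra.
by have := xB 0; rewrite ler_norml => /andP[]; lra.
Qed.

End a_priori.

(** A solution remains a subsolution after a change of coefficients if the
parameter is raised enough to compensate it. *)
Lemma bounded_solution_subsolution q p q' p' l m x B e e' :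
  bounded_solution q p l x -> (forall t, `|x t| <= B) ->
  (forall t, `|q' t - q t| <= e) -> (forall t, `|p' t - p t| <= e') ->
  l + B * e + e' <= m -> subsolution q' p' m x.
Proof.
move=> [[_ xd] _] xB qe pe lm.
have aeF := ae_filter_ringOfSetsType mu.
apply: filterS xd => t xd; exists (riccati q p l t (x t)) => //.
rewrite /riccati -!addrA lerD2l.
have : (q t - q' t) * x t <= B * e.
  rewrite (le_trans (ler_norm _))// normrM mulrC distrC.
  by apply: ler_pM.
have : p t - p' t <= e' by rewrite (le_trans (ler_norm _))// distrC.
by lra.
Qed.

Section bifurcation_value.
Variables (q p : R -> R) (k : R).
Hypotheses (mq : measurable_fun setT q) (mp : measurable_fun setT p).
Hypotheses (qk : forall t, `|q t| <= k) (pk : forall t, `|p t| <= k).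

(** At [l = k] the function 0 is a subsolution since [p + k >= 0]. *)
Lemma has_bounded_solution_at_bound : has_bounded_solution q p k.
Proof.
pose K := k + `|k| + 3.
have k0 : 0 <= k by exact: le_trans (qk 0).
apply: (@bounded_solution_of_subsolutions _ q p k k K) => // n.
exists (cst 0), 0; split.
- by move=> s t; rewrite subrr normr0 mul0r.
- by move=> t; rewrite normr0 /K; have := normr_ge0 k; lra.
apply: aeW => t; exists 0; first exact: is_derive_cst.
rewrite /riccati expr0n/= mulr0 oppr0 !add0r.
rewrite addrA addr_ge0//.
by rewrite -lerBlDr sub0r; have := pk t; rewrite ler_norml => /andP[].
Qed.

(** The bifurcation value is the infimum of the parameters with a bounded
solution: for [l] at or above it, solutions at parameters less than [1/(n+1)]
above the infimum are subsolutions at [l + 1/(n+1)], and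
[bounded_solution_norm_le] bounds them uniformly. *)
Lemma bifurcation_value_exists :
  exists2 l, - k - k ^+ 2 <= l <= k & is_bifurcation_value q p l.
Proof.
pose S := [set l | has_bounded_solution q p l].
have S0 : S k := has_bounded_solution_at_bound.
have Slb l : S l -> - k - k ^+ 2 <= l.
  by move=> [x xsol]; exact: (bounded_solution_lambda_ge qk pk xsol).
have Sinf : has_inf S by split; [exists k|exists (- k - k ^+ 2) => l /Slb].
have infle l : S l -> inf S <= l by move=> Sl; exact: (inf_lbound Sinf.2).
exists (inf S).
  by rewrite infle// andbT; apply: lb_le_inf => //; exists k.
move=> l; split; first exact: infle.
move=> Sl; pose K := k + `|inf S| + `|l| + 3.
apply: (@bounded_solution_of_subsolutions _ q p k l K) => //.
  by rewrite /K; have := normr_ge0 (inf S); lra.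
move=> n; have [l' Sl' l'S] := inf_adherent (@harmonic_gt0 R n) Sinf.
have [x xsol] := Sl'; have [L xL] := bounded_solution_lipschitz qk pk xsol.
exists x, L; split=> //.
  move=> t; rewrite (le_trans (bounded_solution_norm_le qk pk xsol t))// /K.
  have h1 : harmonic n <= 1 :> R by rewrite /= invf_le1// ler1n.
  have : `|l'| <= `|inf S| + 1.
    have := infle _ Sl'; have := ler_norm (inf S); have := ler_norm (- inf S).
    by rewrite normrN ler_norml; lra.
  by have := normr_ge0 l; lra.
apply: (@bounded_solution_subsolution q p q p l' _ x _ 0 0 xsol).
- exact: (bounded_solution_norm_le qk pk xsol).
- by move=> t; rewrite subrr normr0.
- by move=> t; rewrite subrr normr0.
- by rewrite mulr0 !addr0; move: l'S; lra.
Qed.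

End bifurcation_value.

End bifurcation.

(** * Dependence of the bifurcation value on the coefficients *)

Section lambda_star.
Context {R : realType}.
Implicit Types q p : BPUC R.

Lemma BPUC_measurable q : measurable_fun setT q.
Proof.
have [n [a [qs [_ aq ->]]]] := asboolW (BPUC_mem q).
have -> : \sum_(i < n) qs i = (fun t => \sum_(i < n) qs i t).
  by apply/funext => t; rewrite fct_sumE.
apply: measurable_sum => i; apply: right_continuous_measurable.
by have [] := aq i.
Qed.

Lemma BPUC_le_norm (k : R) q : `|q| <= k -> forall t, `|q t| <= k.
Proof. by move=> qk t; apply: le_trans qk; exact: BPUC_norm_ub. Qed.

Lemma lambda_starP q p : is_bifurcation_value q p (lambda_star q p).
Proof.
pose k := Num.max `|q| `|p|.
have qk : forall t, `|q t| <= k by apply: BPUC_le_norm; rewrite le_max lexx.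
have pk : forall t, `|p t| <= k.
  by apply: BPUC_le_norm; rewrite le_max lexx orbT.
have [l _ ql] :=
  bifurcation_value_exists (BPUC_measurable q) (BPUC_measurable p) qk pk.
exact: (@xgetPex _ 0 [set l | is_bifurcation_value q p l] (ex_intro _ l ql)).
Qed.

Lemma lambda_star_bounds (k : R) q p : `|q| <= k -> `|p| <= k ->
  - k - k ^+ 2 <= lambda_star q p <= k.
Proof.
move=> /BPUC_le_norm qk /BPUC_le_norm pk.
have [l lk ql] :=
  bifurcation_value_exists (BPUC_measurable q) (BPUC_measurable p) qk pk.
by rewrite (is_bifurcation_value_unique (@lambda_starP q p) ql).
Qed.

(** It dominates the a priori bound [k + |l| + 2] of the bounded solutions, as
[|l| <= k + k^2] for a bifurcation value [l], and also the factor 1 in front of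
the distance between the inhomogeneous terms. *)
Definition lambda_star_lipschitz_const (k : R) : R := k ^+ 2 + 2 * k + 3.

(** The bounded solution [x] at [l = lambda_star q p], bounded by [B], is a
subsolution of the other equation at [l + B * |qbar - q| + |pbar - p|]. *)
Lemma lambda_star_le (k : R) q qbar p pbar :
  `|q| <= k -> `|qbar| <= k -> `|p| <= k -> `|pbar| <= k ->
  lambda_star qbar pbar <= lambda_star q p +
    lambda_star_lipschitz_const k * (`|qbar - q| + `|pbar - p|).
Proof.
move=> qk qbk pk pbk; set l := lambda_star q p.
set m := lambda_star_lipschitz_const k.
set e := `|qbar - q|; set e' := `|pbar - p|.
have k0 : 0 <= k by exact: le_trans qk.
have [x xsol] : has_bounded_solution q p l by apply/lambda_starP.
have qk' := BPUC_le_norm qk; have pk' := BPUC_le_norm pk.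
have qbk' := BPUC_le_norm qbk; have pbk' := BPUC_le_norm pbk.
have [L xL] := bounded_solution_lipschitz qk' pk' xsol.
have xB := bounded_solution_norm_le qk' pk' xsol.
set B := k + `|l| + 2 in xB.
have Bm : B <= m.
  have /andP[l1 l2] := lambda_star_bounds qk pk; rewrite -/l in l1 l2.
  have : `|l| <= k + k ^+ 2.
    by rewrite ler_norml; have := sqr_ge0 k; lra.
  by rewrite /B /m /lambda_star_lipschitz_const; lra.
have m1 : 1 <= m.
  by rewrite /m /lambda_star_lipschitz_const; have := sqr_ge0 k; lra.
apply/lambda_starP.
pose K := Num.max B (k + `|l + m * (e + e')| + 3).
apply: (@bounded_solution_of_subsolutions _ qbar pbar k _ K) => //.
- exact: BPUC_measurable.
- exact: BPUC_measurable.
- by rewrite le_max lexx orbT.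
move=> n; exists x, L; split=> //.
  by move=> t; rewrite le_max xB.
have e0 : 0 <= e by exact: normr_ge0.
have e'0 : 0 <= e' by exact: normr_ge0.
apply: (@bounded_solution_subsolution _ q p qbar pbar l _ x B e e' xsol) => //.
- by move=> t; exact: (BPUC_norm_ub (qbar - q)).
- by move=> t; exact: (BPUC_norm_ub (pbar - p)).
apply: (@le_trans _ _ (l + m * (e + e'))); last first.
  by rewrite lerDl ltW// harmonic_gt0.
rewrite -addrA lerD2l mulrDr lerD// ?ler_wpM2r//.
by rewrite ler_peMl.
Qed.

Lemma lambda_star_dist_le (k : R) q qbar p pbar :
  `|q| <= k -> `|qbar| <= k -> `|p| <= k -> `|pbar| <= k ->
  `|lambda_star qbar pbar - lambda_star q p|
    <= lambda_star_lipschitz_const k * (`|qbar - q| + `|pbar - p|).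
Proof.
move=> qk qbk pk pbk; rewrite ler_norml lerBlDl lambda_star_le// andbT.
rewrite lerNl opprB lerBlDl [`|qbar - q|]distrC [`|pbar - p|]distrC.
exact: lambda_star_le.
Qed.

Lemma lambda_star_continuous :
  continuous (fun qp : BPUC R * BPUC R => lambda_star qp.1 qp.2).
Proof.
move=> [q p]; apply/cvgrPdist_lt => e e0 /=.
(* Within distance 1 of (q, p) all norms are at most k, so that one Lipschitz
   constant serves on the whole ball. *)
pose k := Num.max `|q| `|p| + 1.
pose m := lambda_star_lipschitz_const k.
have k1 : 1 <= k by rewrite lerDr le_max normr_ge0.
have m0 : 0 < m.
  by rewrite /m /lambda_star_lipschitz_const; have := sqr_ge0 k; lra.
have d0 : 0 < e / (2 * m) by rewrite divr_gt0// mulr_gt0.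
near=> z.
have z1 : `|z.1 - q| < Num.min 1 (e / (2 * m)).
  near: z; apply: cvgr_distC_lt; first exact: cvg_fst.
  by rewrite lt_min ltr01.
have z2 : `|z.2 - p| < Num.min 1 (e / (2 * m)).
  near: z; apply: cvgr_distC_lt; first exact: cvg_snd.
  by rewrite lt_min ltr01.
move: z1 z2; rewrite !lt_min => /andP[z11 z1d] /andP[z21 z2d].
have zk (a b : BPUC R) : `|b| <= Num.max `|q| `|p| -> `|a - b| < 1 -> `|a| <= k.
  move=> bk ab; rewrite -(subrK b a) (le_trans (ler_normD _ _))// addrC lerD//.
  exact: ltW.
have qm : `|q| <= Num.max `|q| `|p| by rewrite le_max lexx.
have pm : `|p| <= Num.max `|q| `|p| by rewrite le_max lexx orbT.
rewrite distrC (le_lt_trans (@lambda_star_dist_le k _ _ _ _ _ _ _ _))//.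
- by rewrite (le_trans qm)// lerDl.
- exact: zk z11.
- by rewrite (le_trans pm)// lerDl.
- exact: zk z21.
have dE : m * (e / (2 * m)) = e / 2 by field; rewrite gt_eqF.
rewrite [ltRHS]splitr -dE mulrDr; apply: ltrD; by rewrite ltr_pM2l.
Unshelve. all: by end_near. Qed.

End lambda_star.

Theorem theorem2p12 (R : realType) :
  (forall kappa : R, exists m : R,
     forall q qbar p pbar : BPUC R,
       `|q| <= kappa -> `|qbar| <= kappa ->
       `|p| <= kappa -> `|pbar| <= kappa ->
       `|lambda_star qbar pbar - lambda_star q p|
         <= m * (`|qbar - q| + `|pbar - p|))
  /\ continuous (fun qp : BPUC R * BPUC R => lambda_star qp.1 qp.2).
Proof.
split=> [kappa|]; last exact: lambda_star_continuous.
exists (lambda_star_lipschitz_const kappa) => q qbar p pbar.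
exact: lambda_star_dist_le.
Qed.
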